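(* Let $\mathcal M\in\mathcal{LAB}$. (1) The map $\Psi\mapsto X(\Psi)$ is one-to-one from the collection of nonempty closed $FIN(\mathbb N)$-invariant subsets of $\Theta(\mathcal M)$ to the collection of nonempty closed $S$-invariant subsets of $X(\mathcal M)$. (2) If $\mathcal M$ is of finite type then this map is surjective, i.e. every nonempty closed $S$-invariant subset $Y$ of $X(\mathcal M)$ is of the form $X(\Psi)$ for some nonempty closed $FIN(\mathbb N)$-invariant $\Psi\subset\Theta(\mathcal M)$, with $\Phi(X(\Psi))=\Psi$ and $Y=X(\Phi(Y))$. Similar statements hold for $X_+(\mathcal M)$, i.e. (1) and (2) hold with $X(\cdot)$, $\Phi(\cdot)$, $x[\cdot]$ replaced by $X_+(\cdot)$, $\Phi_+(\cdot)$, $x_+[\cdot]$.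
   Context: Write $\mathbb N=\{1,2,\dots\}$. An $\mathbb N$-vector is a function $\mathbf m:\mathbb N\to\{0,1,2,\dots\}$ with finite support $\mathrm{supp}\,\mathbf m$; $FIN(\mathbb N)$ is the additive monoid of all $\mathbb N$-vectors, with identity $\mathbf 0$ and the pointwise order. A label is a set $\mathcal M\subset FIN(\mathbb N)$ such that $\mathbf 0\le\mathbf m_1\le\mathbf m\in\mathcal M$ implies $\mathbf m_1\in\mathcal M$; it is of finite type if it contains no infinite strictly increasing sequence. $\mathcal{LAB}$ is the space of all labels (including $\emptyset$) with the ultrametric $d(\mathcal M_1,\mathcal M_2)=\inf\{2^{-N}:N\ge0,\ \mathcal M_1\cap\mathcal B_N=\mathcal M_2\cap\mathcal B_N\}$, where $\mathcal B_N$ is the set of $\mathbb N$-vectors $\mathbf m$ with $\mathbf m_\ell<N$ for all $\ell$ and $\mathrm{supp}\,\mathbf m\subset[1,N]$. $FIN(\mathbb N)$ acts on $\mathcal{LAB}$ by $P_{\mathbf r}(\mathcal M)=\mathcal M-\mathbf r=\{\mathbf w\in FIN(\mathbb N):\mathbf w+\mathbf r\in\mathcal M\}$; $\Psi\subset\mathcal{LAB}$ is $FIN(\mathbb N)$-invariant if $P_{\mathbf r}(\Psi)\subset\Psi$ for all $\mathbf r$. $\Theta(\mathcal M)$ is the closure in $\mathcal{LAB}$ of $\{\mathcal M-\mathbf r:\mathbf r\in FIN(\mathbb N)\}$. Fix an odd integer $b\ge5$ and a partition $\{D_\ell:\ell\in\mathbb N\}$ of $\mathbb N$ into infinite sets with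 $\min D_\ell<\min D_{\ell+1}$. Define $k:\mathbb Z\to\mathbb Z$ by $k(n)=b^{n-1}$ for $n\ge1$, $k(0)=0$, $k(-n)=-k(n)$. $IP(k)$ (resp. $IP_+(k)$) is the set of sums of finite subsets of $k(\mathbb Z)$ (resp. of $k(\{0,1,2,\dots\})$). Each $t\in IP(k)$ has a unique expansion $t=k(j_1)+\dots+k(j_r)$ with $|j_1|>\dots>|j_r|>0$ ($r=0$ for $t=0$); its length vector $\mathbf r(t)\in FIN(\mathbb N)$ is $\mathbf r(t)_\ell=\#\{i:|j_i|\in D_\ell\}$. For a label $\mathcal M$, $A[\mathcal M]=\{t\in IP(k):\mathbf r(t)\in\mathcal M\}$, $A_+[\mathcal M]=A[\mathcal M]\cap IP_+(k)$, and $x[\mathcal M],x_+[\mathcal M]\in\{0,1\}^{\mathbb Z}$ are the characteristic functions of $A[\mathcal M]$ and $A_+[\mathcal M]$. $S$ is the shift on $\{0,1\}^{\mathbb Z}$, $S(x)_t=x_{t+1}$. $X(\mathcal M)$, $X_+(\mathcal M)$ are the orbit closures (under $S^n$, $n\in\mathbb Z$) of $x[\mathcal M]$, $x_+[\mathcal M]$. For a nonempty $\Psi\subset\mathcal{LAB}$, $X(\Psi)$ (resp. $X_+(\Psi)$) is the smallest closed shift-invariant set containing $x[\mathcal N]$ (resp. $x_+[\mathcal N]$) for all $\mathcal N\in\Psi$. For $Y\subset\{0,1\}^{\mathbb Z}$, $\Phi(Y)=\{\mathcal N\in\mathcal{LAB}:x[\mathcal N]\in Y\}$ and $\Phi_+(Y)=\{\mathcal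 N\in\mathcal{LAB}:x_+[\mathcal N]\in Y\}$. *)

(* Defs.v *)
From HB Require Import structures.
From mathcomp Require Import all_boot all_order all_algebra.
From mathcomp Require Import boolp classical_sets functions cardinality fsbigop.
From mathcomp Require Import reals interval_inference Rstruct topology normedtype.

Set Implicit Arguments.
Unset Strict Implicit.
Unset Printing Implicit Defensive.

Import Order.TTheory GRing.Theory Num.Theory.

Local Open Scope classical_set_scope.
Local Open Scope ring_scope.

(* The index set {1, 2, ...}. *)
Definition NN : set nat := [set n | (0 < n)%N].

Definition supp (m : nat -> nat) : set nat := [set l | m l != 0%N].

(* A function on {1, 2, ...} is represented by its extension by 0 at 0, so that
   indices keep their usual values.  Sum and order on nat -> nat are the
   pointwise ones of the library. *)
Definition FIN : set (nat -> nat) :=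
  [set m | finite_set (supp m) /\ supp m `<=` NN].

Definition is_label (M : set (nat -> nat)) : Prop :=
  M `<=` FIN /\
  forall m1 m, FIN m1 -> (m1 <= m)%O -> M m -> M m1.

Record LAB := Label { label_set :> set (nat -> nat) ; labelP : is_label label_set }.

Definition finite_type (M : LAB) : Prop :=
  ~ exists u : nat -> (nat -> nat),
      range u `<=` M /\ (forall n, (u n < u n.+1)%O).

Lemma LAB_eq (M1 M2 : LAB) : label_set M1 = label_set M2 -> M1 = M2.
Proof.
by case: M1 M2 => [A PA] [B PB] /= AB; subst B; congr Label; exact: Prop_irrelevance.
Qed.

Definition BB (N : nat) : set (nat -> nat) :=
  [set m | [/\ FIN m, forall l, NN l -> (m l < N)%N &
               supp m `<=` [set l | (1 <= l <= N)%N]]].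

Definition agree (M1 M2 : set (nat -> nat)) : set nat :=
  [set N | M1 `&` BB N = M2 `&` BB N].

Definition LAB_dist (M1 M2 : LAB) : Rdefinitions.R :=
  inf [set 2 ^- N | N in agree M1 M2].

Lemma BB_sub N N' : (N <= N')%N -> BB N `<=` BB N'.
Proof.
move=> NN' m [mF mN ms]; split => // [l l0|l /ms /andP[l1 lN]].
  exact: leq_trans (mN l l0) NN'.
by rewrite /= l1 (leq_trans lN).
Qed.

Lemma agree_le M1 M2 N N' : (N <= N')%N -> agree M1 M2 N' -> agree M1 M2 N.
Proof.
move=> leN eqN'; rewrite /agree /=.
have -> : BB N = BB N' `&` BB N by apply/esym/setIidPr; exact: BB_sub.
by rewrite !setIA eqN'.
Qed.

Lemma agree0 M1 M2 : agree M1 M2 0%N.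
Proof.
have B0 : BB 0 = set0 by rewrite -subset0 => m [_ /(_ 1%N isT)].
by rewrite /agree /= B0 !setI0.
Qed.

Lemma agree_trans M1 M2 M3 N :
  agree M1 M2 N -> agree M2 M3 N -> agree M1 M3 N.
Proof. by rewrite /agree /= => -> ->. Qed.

Lemma LAB_dist_has_inf (M1 M2 : LAB) :
  has_inf [set (2 ^- N : Rdefinitions.R) | N in agree M1 M2].
Proof.
split; first by exists (2 ^- 0); exists 0%N => //; exact: agree0.
by exists 0 => _ [N _ <-]; rewrite invr_ge0 exprn_ge0.
Qed.

Lemma LAB_dist_ge0 (M1 M2 : LAB) : 0 <= LAB_dist M1 M2.
Proof.
apply: lb_le_inf; first by have [] := LAB_dist_has_inf M1 M2.
by move=> _ [N _ <-]; rewrite invr_ge0 exprn_ge0.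
Qed.

Lemma LAB_dist_le (M1 M2 : LAB) N : agree M1 M2 N -> LAB_dist M1 M2 <= 2 ^- N.
Proof.
move=> aN; apply: ge_inf; last by exists N.
by have [] := LAB_dist_has_inf M1 M2.
Qed.

Lemma LAB_dist_lt (M1 M2 : LAB) e :
  LAB_dist M1 M2 < e -> exists2 N, agree M1 M2 N & 2 ^- N < e.
Proof.
move=> /(inf_lt (LAB_dist_has_inf M1 M2).1) [_ [N aN <-] lte].
by exists N.
Qed.

Lemma LAB_dist_ultra (M2 M1 M3 : LAB) :
  LAB_dist M1 M3 <= Num.max (LAB_dist M1 M2) (LAB_dist M2 M3).
Proof.
apply/ler_addgt0Pr => e e0; set c := Num.max _ _.
have ltc : c < c + e by rewrite ltrDl.
have [|N aN ltN] := @LAB_dist_lt M1 M2 (c + e).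
  by apply: le_lt_trans ltc; rewrite le_max lexx.
have [|K aK ltK] := @LAB_dist_lt M2 M3 (c + e).
  by apply: le_lt_trans ltc; rewrite le_max lexx orbT.
case: (leqP N K) => NK.
  apply: le_trans (ltW ltN); apply: LAB_dist_le.
  exact: agree_trans aN (agree_le NK aK).
apply: le_trans (ltW ltK); apply: LAB_dist_le.
exact: agree_trans (agree_le (ltnW NK) aN) aK.
Qed.

Lemma LAB_distxx (M : LAB) : LAB_dist M M = 0.
Proof.
apply/eqP; rewrite eq_le LAB_dist_ge0 andbT; apply/ler_addgt0Pr => e e0.
rewrite add0r.
have [N _ /(_ N (leqnn N)) /= ltN] :=
  @near_infty_natSinv_expn_lt Rdefinitions.R (PosNum e0).
rewrite div1r in ltN.
by apply: le_trans (ltW ltN); exact: LAB_dist_le.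
Qed.

Lemma LAB_dist_sym (M1 M2 : LAB) : LAB_dist M1 M2 = LAB_dist M2 M1.
Proof.
rewrite /LAB_dist; congr (inf (_ @` _)); apply/seteqP.
by split => N; rewrite /agree /= => ->.
Qed.

Lemma LAB_dist_triangle (M2 M1 M3 : LAB) :
  LAB_dist M1 M3 <= LAB_dist M1 M2 + LAB_dist M2 M3.
Proof.
apply: le_trans (LAB_dist_ultra M2 M1 M3) _.
by rewrite ge_max lerDl lerDr !LAB_dist_ge0.
Qed.

Lemma FIN_BB m : FIN m -> exists N, BB N m.
Proof.
move=> mF; have [/finite_seqP[s sE] sub] := mF.
exists (\max_(l <- s) maxn l (m l)).+1.
have le l : supp m l -> (maxn l (m l) <= \max_(l <- s) maxn l (m l))%N.
  by rewrite sE /= => ls; exact: (@leq_bigmax_seq _ s xpredT (fun l => maxn l (m l))).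
split => // [l _|l ml].
- have [->//|ml] := eqVneq (m l) 0%N.
  by rewrite ltnS (leq_trans _ (le l ml))// leq_maxr.
- apply/andP; split; first exact: sub.
  by rewrite (leq_trans _ (leqW (le l ml)))// leq_maxl.
Qed.

Lemma LAB_dist_eq0 (M1 M2 : LAB) : LAB_dist M1 M2 = 0 -> M1 = M2.
Proof.
move=> d0; have ag N : agree M1 M2 N.
  have [|K aK ltK] := @LAB_dist_lt M1 M2 (2 ^- N).
    by rewrite d0 invr_gt0 exprn_gt0.
  apply: agree_le aK; apply: ltnW.
  by move: ltK; rewrite ltf_pV2 ?posrE ?exprn_gt0// ltr_eXn2l ?ltr1n.
apply: LAB_eq; apply/seteqP; split => m Mm.
- have [N BN] := FIN_BB ((labelP M1).1 m Mm).
  by have : (label_set M1 `&` BB N) m by []; rewrite (ag N) => -[].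
- have [N BN] := FIN_BB ((labelP M2).1 m Mm).
  by have : (label_set M2 `&` BB N) m by []; rewrite -(ag N) => -[].
Qed.

HB.instance Definition _ := gen_eqMixin LAB.
HB.instance Definition _ := gen_choiceMixin LAB.
HB.instance Definition _ := @isMetric.Build Rdefinitions.R LAB LAB_dist
  LAB_distxx LAB_dist_eq0 LAB_dist_sym LAB_dist_triangle.

Lemma shift_label_subproof (r : nat -> nat) (M : LAB) :
  is_label [set w | FIN w /\ label_set M (w + r)].
Proof.
split=> [w []//|w1 w w1F /asboolP le1 [wF Mw]]; split => //.
have le2 : (w1 + r <= w + r)%O by apply/asboolP => l; exact: leq_add (le1 l) (leqnn _).
apply: ((labelP M).2 _ _ _ le2 Mw); have [fs sub] := (labelP M).1 _ Mw.
have ss : supp (w1 + r) `<=` supp (w + r).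
  move=> l; rewrite /supp /= -!lt0n => /leq_trans; apply; exact: (asboolP _ le2 l).
by split; [exact: sub_finite_set fs | exact: subset_trans sub].
Qed.

Definition shift_label (r : nat -> nat) (M : LAB) : LAB :=
  Label (shift_label_subproof r M).

Definition FIN_invariant (Psi : set LAB) : Prop :=
  forall r, FIN r -> shift_label r @` Psi `<=` Psi.

Definition Theta (M : LAB) : set LAB :=
  closure [set shift_label r M | r in FIN].

Definition is_min (A : set nat) (n : nat) : Prop := A n /\ lbound A n.

Definition good_partition (D : nat -> set nat) : Prop :=
  [/\ partition NN D NN,
      forall l, NN l -> infinite_set (D l) &
      forall l i j, NN l -> is_min (D l) i -> is_min (D l.+1) j -> (i < j)%N].

(* [Negz n] is -(n+1). *)
Definition k (b : nat) (n : int) : int :=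
  match n with
  | Posz 0 => 0
  | Posz n.+1 => b%:Z ^+ n
  | Negz n => - b%:Z ^+ n
  end.

Definition subset_sums (A : set int) : set int :=
  [set t | exists F : set int,
     [/\ finite_set F, F `<=` A & t = \sum_(x \in F) x]].

Definition IP (b : nat) : set int := subset_sums (range (k b)).

Definition IP_plus (b : nat) : set int :=
  subset_sums (k b @` [set n | 0 <= n]).

Definition is_expansion (b : nat) (t : int) (s : seq int) : Prop :=
  [/\ sorted (fun i j => (`|j| < `|i|)%N) s,
      all (fun j => (0 < `|j|)%N) s &
      t = \sum_(j <- s) k b j].

(* For b >= 3 every t in IP b has exactly one expansion; the default [::] is
   only used outside IP b. *)
Definition expansion (b : nat) (t : int) : seq int :=
  xget [::] [set s | is_expansion b t s].

Definition length_vector (b : nat) (D : nat -> set nat) (t : int) : nat -> nat :=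
  fun l => if l == 0%N then 0%N
           else count (fun j => `[< D l `|j|%N >]) (expansion b t).

Definition Aset (b : nat) (D : nat -> set nat) (M : LAB) : set int :=
  [set t | IP b t /\ label_set M (length_vector b D t)].

Definition Aset_plus (b : nat) (D : nat -> set nat) (M : LAB) : set int :=
  Aset b D M `&` IP_plus b.

Definition shift_space : Type := prod_topology (fun _ : int => bool).

HB.instance Definition _ := Nbhs.on shift_space.
HB.instance Definition _ := Topological.on shift_space.

Definition charfun (A : set int) : shift_space := fun t => `[< A t >].

Definition xlab (b : nat) (D : nat -> set nat) (M : LAB) : shift_space :=
  charfun (Aset b D M).

Definition xlab_plus (b : nat) (D : nat -> set nat) (M : LAB) : shift_space :=
  charfun (Aset_plus b D M).

(* [Siter n] is the n-th iterate of the shift, for n in Z. *)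
Definition Siter (n : int) (x : shift_space) : shift_space :=
  fun t => x (t + n).

Definition Sshift : shift_space -> shift_space := Siter 1.

Definition S_invariant (Y : set shift_space) : Prop := Sshift @` Y = Y.

Definition orbit_closure (x : shift_space) : set shift_space :=
  closure (range (fun n => Siter n x)).

Definition generated_subshift (G : set shift_space) : set shift_space :=
  smallest (fun Y => closed Y /\ S_invariant Y) G.

Definition Xlab (b : nat) (D : nat -> set nat) (M : LAB) : set shift_space :=
  orbit_closure (xlab b D M).

Definition Xlab_plus (b : nat) (D : nat -> set nat) (M : LAB) : set shift_space :=
  orbit_closure (xlab_plus b D M).

Definition X (b : nat) (D : nat -> set nat) (Psi : set LAB) : set shift_space :=
  generated_subshift (xlab b D @` Psi).

Definition X_plus (b : nat) (D : nat -> set nat) (Psi : set LAB) : set shift_space :=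
  generated_subshift (xlab_plus b D @` Psi).

Definition Phi (b : nat) (D : nat -> set nat) (Y : set shift_space) : set LAB :=
  [set N | Y (xlab b D N)].

Definition Phi_plus (b : nat) (D : nat -> set nat) (Y : set shift_space) : set LAB :=
  [set N | Y (xlab_plus b D N)].

Definition closed_invariant_label_sets (T : set LAB) : set (set LAB) :=
  [set Psi | [/\ Psi !=set0, closed Psi, FIN_invariant Psi & Psi `<=` T]].

Definition closed_invariant_subsets (Z : set shift_space) :
    set (set shift_space) :=
  [set Y | [/\ Y !=set0, closed Y, S_invariant Y & Y `<=` Z]].

(* Main.v *)
Require Import Defs.
From mathcomp Require Import all_boot all_order all_algebra.
From mathcomp Require Import boolp classical_sets functions cardinality fsbigop.
From mathcomp Require Import reals interval_inference Rstruct topology normedtype.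
From mathcomp Require Import zify.

Set Implicit Arguments.
Unset Strict Implicit.
Unset Printing Implicit Defensive.

Import Order.TTheory GRing.Theory Num.Theory.

Local Open Scope classical_set_scope.
Local Open Scope ring_scope.

(** Write b = 2h + 1 with h >= 2.  Every integer has a unique expansion in base b
with digits in [-h, h], and the elements of IP(k) are the integers whose
balanced digits all lie in {-1, 0, 1} ({0, 1} for IP_+(k)).  The point of
balanced digits is that no carry occurs: if b^K divides v and |s| <= K, then
the digits of s and v occupy disjoint positions in s + v, so that s + v is in
IP(k) iff s and v are, and then r(s + v) = r(s) + r(v).
The two versions of the statement differ only in the set of admissible digits,
and both are obtained from one proof depending on a boolean p, which is true
when the digit -1 is excluded.

Since the blocks of the partition are infinite, every vector r is the length
vector of some v divisible by an arbitrarily high power of the base.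
Translating x[N] by such a v shows x[N - r] on a large window.  As moreover
x[N] depends continuously on N, the set of labels N with x[N] in Y, for Y closed
and shift invariant, is closed and FIN-invariant (closed_points_in,
FIN_invariant_points_in).

Conversely suppose x[N] agrees with a translate S^n x[N'] on a large window,
where N is not empty (label_of_limit_point).  As 0 is in A[N], n is in A[N'].
If n had a low digit e <> 0 in position j, erasing it would give a point of
A[N'], so -e b^j, and by symmetry of length vectors e b^j, would be in A[N];
then n + e b^j would be in A[N'] with a digit 2e, which is impossible because
h >= 2.  So n is divisible by a high power of the base, and N is close to
N' - r(n).  It follows that a closed invariant set of labels is determined, up
to the empty label, by the subshift it generates.  The empty label is harmless:
labels only shrink under the action, so inside Theta(M) every member of Psi has
the empty label as a shift unless M is the set of all vectors, in which case
Theta(M) is a single point (empty_label_mem).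

For surjectivity, a nonzero y in X(M) can be translated so that y(0) = 1; then
the low digits of any n for which y looks like S^n x[M] are dictated by y
itself (window_digitP).  The length vectors of the truncations of this limiting
digit sequence are in M, so finite type forces the sequence to vanish from some
position on; translating it away leaves a limit along integers divisible by
arbitrarily high powers of the base, and such a limit is some x[N]
(limit_along_powers).  The zero sequence being the point of the empty label,
every point of X(M) is a translate of some x[N]. *)

(** * Balanced digits *)
Definition quot (b : nat) (t : int) : int := ((t + (b./2)%:Z) %/ b%:Z)%Z.

Definition digit (b j : nat) (t : int) : int :=
  iter j (quot b) t - b%:Z * iter j.+1 (quot b) t.

Section Digits.
Context (b : nat) (b_odd : odd b) (b_ge5 : (5 <= b)%N).

Local Notation h := (b./2).
Local Notation q := (quot b).
Local Notation dig := (digit b).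

Let bE : b%:Z = h%:Z + h%:Z + 1.
Proof. have := odd_double_half b; rewrite b_odd; lia. Qed.

Let h_ge2 : (2 <= h)%N.
Proof. have := odd_double_half b; rewrite b_odd; lia. Qed.

Let b_neq0 : b%:Z != 0. Proof. lia. Qed.

Lemma quotP t : `|t - b%:Z * q t| <= h%:Z.
Proof.
rewrite /quot; have b_gt0 : 0 < b%:Z by lia.
have := divz_eq (t + h%:Z) b%:Z.
have := ltz_pmod (t + h%:Z) b_gt0; have := modz_ge0 (t + h%:Z) b_neq0.
by set r := (_ %% _)%Z; set w := (_ %/ _)%Z; rewrite [b%:Z * w]mulrC; lia.
Qed.

Lemma quot_uniq w e : `|e| <= h%:Z -> q (e + b%:Z * w) = w.
Proof.
move=> eh; rewrite /quot [b%:Z * w]mulrC addrAC [_ + w * _]addrC divzMDl//.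
by rewrite divz_small ?addr0//; lia.
Qed.

Lemma quot0 : q 0 = 0.
Proof. by have := @quot_uniq 0 0; rewrite mulr0 addr0; apply; lia. Qed.

Lemma quot_lt t : t != 0 -> (`|q t| < `|t|)%N.
Proof.
move=> t0; have := quotP t; have [->|q0] := eqVneq (q t) 0; first lia.
move=> tq; suff : b%:Z * `|q t| <= `|t| + h%:Z by move: bE; nia.
rewrite -[b%:Z]/(`|b%:Z|) -normrM. lia.
Qed.

Lemma iter_quot_small K t : (`|t| <= K)%N -> iter K q t = 0.
Proof.
elim: K t => [|K IH] t /=; first lia.
move=> tK; rewrite -iterS iterSr; apply: IH; have [->|/quot_lt] := eqVneq t 0; last lia.
by rewrite quot0.
Qed.

Lemma digitS j t : dig j.+1 t = dig j (q t).
Proof. by rewrite /digit -!iterSr. Qed.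

Lemma digit_iter K j t : dig j (iter K q t) = dig (K + j) t.
Proof. by rewrite /digit -!iterD addSn addnC. Qed.

Lemma digit_bound j t : `|dig j t| <= h%:Z.
Proof. exact: quotP. Qed.

(** Reading digits from a prescribed digit sequence: the quotients peel off the
terms one by one because each [e i] is already a centred remainder. *)
Lemma digit_cat (e : nat -> int) (w : int) K : (forall i, (i < K)%N -> `|e i| <= h%:Z) ->
  iter K q (\sum_(i < K) e i * b%:Z ^+ i + b%:Z ^+ K * w) = w /\
  forall j, dig j (\sum_(i < K) e i * b%:Z ^+ i + b%:Z ^+ K * w) =
            if (j < K)%N then e j else dig (j - K) w.
Proof.
elim: K e => [|K IH] e eh.
  by rewrite big_ord0 add0r expr0 mul1r; split=> // j; rewrite subn0.
have [/= IH1 IH2] := IH (fun i => e i.+1) (fun i => eh i.+1).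
set t := (X in iter _ _ X); set u := (X in iter _ _ X = _) in IH1.
have tE : t = e 0%N + b%:Z * u.
  rewrite /t /u big_ord_recl expr0 mulr1 mulrDr mulr_sumr mulrA -exprS addrA.
  congr (_ + _ + _); apply: eq_bigr => i _.
  by rewrite lift0 exprS mulrCA.
have qt : q t = u by rewrite tE quot_uniq// eh.
split=> [|[|j]]; first by rewrite -iterS iterSr qt.
- by rewrite -/t /digit /= qt tE addrK.
- by rewrite -/t digitS qt IH2.
Qed.

Lemma digit_sum (e : nat -> int) (w : int) K : (forall i, (i < K)%N -> `|e i| <= h%:Z) ->
  forall j, dig j (\sum_(i < K) e i * b%:Z ^+ i + b%:Z ^+ K * w) =
            if (j < K)%N then e j else dig (j - K) w.
Proof. by move=> /digit_cat-/(_ w)[]. Qed.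

Lemma digit_expand K t :
  t = \sum_(i < K) dig i t * b%:Z ^+ i + b%:Z ^+ K * iter K q t.
Proof.
elim: K => [|K IH]; first by rewrite big_ord0 add0r expr0 mul1r.
rewrite big_ord_recr /= -addrA {1}IH; congr (_ + _).
by rewrite /digit exprSr -mulrA [_ * b%:Z ^+ K]mulrC -mulrDr subrK.
Qed.

Lemma digit_small j t : (`|t| <= j)%N -> dig j t = 0.
Proof.
move=> tj; rewrite /digit /= iter_quot_small// quot0; lia.
Qed.

Lemma digit0 j : dig j 0 = 0.
Proof. exact: digit_small. Qed.

Lemma digit_expand_small K t : (`|t| <= K)%N ->
  t = \sum_(i < K) dig i t * b%:Z ^+ i.
Proof.
by move=> tK; rewrite {1}(digit_expand K t) iter_quot_small// mulr0 addr0.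
Qed.

Lemma digit_mul K j w : dig j (b%:Z ^+ K * w) =
  if (j < K)%N then 0 else dig (j - K) w.
Proof.
have := @digit_sum (fun=> 0) w K (fun _ _ => isT) j.
by rewrite big1 ?add0r// => i _; rewrite mul0r.
Qed.

Lemma digit_split K j s w : (`|s| <= K)%N ->
  dig j (s + b%:Z ^+ K * w) = dig j s + dig j (b%:Z ^+ K * w).
Proof.
move=> sK; rewrite {1}(digit_expand_small sK) (@digit_sum (dig^~ s)); last first.
  by move=> i _; exact: digit_bound.
rewrite digit_mul; case: ifPn => [_|]; first by rewrite addr0.
by rewrite -leqNgt => Kj; rewrite (@digit_small _ s) ?add0r//; lia.
Qed.

(** Altering one digit within the admissible range produces no carry. *)
Lemma digit_change i j t c : `|dig i t + c| <= h%:Z ->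
  dig j (t + c * b%:Z ^+ i) = if j == i then dig i t + c else dig j t.
Proof.
move=> ch; rewrite {1}(digit_expand i t); set w := iter i q t.
have -> : \sum_(i0 < i) dig i0 t * b%:Z ^+ i0 + b%:Z ^+ i * w + c * b%:Z ^+ i =
   \sum_(i0 < i.+1) (if (i0 : nat) == i then dig i t + c else dig i0 t) * b%:Z ^+ i0
     + b%:Z ^+ i.+1 * q w.
  rewrite big_ord_recr /= eqxx -!addrA; congr (_ + _).
    by apply: eq_bigr => -[l /= li] _; rewrite ltn_eqF.
  rewrite -/w iterS -/w exprSr -mulrA ![_ * b%:Z ^+ i]mulrC -!mulrDr.
  by congr (_ * _); lia.
rewrite (@digit_sum (fun k => if k == i then dig i t + c else dig k t)); last first.
  by move=> k _; case: eqP => // _; exact: digit_bound.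
rewrite ltnS; case: ltngtP => // ij.
by rewrite -iterS digit_iter subnKC.
Qed.

Lemma digit_dvd K t : (forall j, (j < K)%N -> dig j t = 0) ->
  t = b%:Z ^+ K * iter K q t.
Proof.
move=> t0; rewrite {1}(digit_expand K t) big1 ?add0r// => i _.
by rewrite t0 ?mul0r.
Qed.

End Digits.

(** * Length vectors in terms of digits *)
Definition ok_digit (p : bool) (e : int) : bool :=
  [|| e == 0, e == 1 | ~~ p && (e == -1)].

Definition IPdigit (b : nat) (p : bool) : set int :=
  [set t | forall j, ok_digit p (digit b j t)].

Definition digit_in (b : nat) (D : nat -> set nat) (l : nat) (t : int) : pred nat :=
  fun j => (digit b j t != 0) && `[< D l j.+1 >].

(** Positions from [`|t|] on carry the digit 0, so the range of the count is
large enough.  Digit [j] belongs to the index [j.+1] of [k]. *)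
Definition lenv (b : nat) (D : nat -> set nat) (t : int) : nat -> nat :=
  fun l => if l == 0%N then 0%N else count (digit_in b D l t) (iota 0 `|t|).

Section LengthVectors.
Context (b : nat) (b_odd : odd b) (b_ge5 : (5 <= b)%N).
Context (D : nat -> set nat).

Local Notation q := (quot b).
Local Notation dig := (digit b).
Local Notation lv := (lenv b D).

Lemma lenv_iota B t l : (`|t| <= B)%N ->
  lv t l = if l == 0%N then 0%N else count (digit_in b D l t) (iota 0 B).
Proof.
move=> tB; rewrite /lenv; case: eqP => // _.
rewrite -(subnKC tB) iotaD count_cat add0n.
rewrite [X in (_ + X)%N](eq_in_count (a2 := pred0)) ?count_pred0 ?addn0// => j.
rewrite mem_iota => /andP[tj _]; rewrite /digit_in digit_small//.
Qed.

Lemma lenv_le t t' : (forall j, dig j t != 0 -> dig j t' != 0) ->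
  (lv t <= lv t')%O.
Proof.
move=> tt'; apply/lefP => l; rewrite leEnat.
rewrite (@lenv_iota (`|t| + `|t'|) t) ?leq_addr//.
rewrite (@lenv_iota (`|t| + `|t'|) t') ?leq_addl//; case: eqP => // _.
by apply: sub_count => j /andP[/tt' t'j Dj]; rewrite /digit_in t'j.
Qed.

Lemma lenv_eq t t' : (forall j, (dig j t == 0) = (dig j t' == 0)) ->
  lv t = lv t'.
Proof. by move=> tt'; apply/le_anti/andP; split; apply: lenv_le => j; rewrite tt'. Qed.

(** Addition without interaction: both the digit condition and the length
vector split along such a sum. *)
Definition disjoint_digits (s t u : int) : Prop := forall j,
  dig j u = dig j s + dig j t /\ (dig j s = 0 \/ dig j t = 0).

Lemma lenv_disjoint s t u : disjoint_digits s t u -> lv u = lv s + lv t.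
Proof.
move=> stu; apply/funext => l.
have -> : (lv s + lv t) l = (lv s l + lv t l)%N by [].
pose B := (`|s| + `|t| + `|u|)%N.
rewrite !(@lenv_iota B) /B; try lia.
case: eqP => // _; rewrite -count_predUI (eq_count (a1 := predI _ _) (a2 := pred0)).
  rewrite count_pred0 addn0; apply: eq_count => j; rewrite /digit_in /=.
  by have [-> [->|->]] := stu j; rewrite ?addr0 ?add0r eqxx ?orbF.
by move=> j; rewrite /digit_in /=; have [_ [->|->]] := stu j; rewrite eqxx ?andbF.
Qed.

Lemma IPdigit_disjoint p s t u : disjoint_digits s t u ->
  IPdigit b p u <-> IPdigit b p s /\ IPdigit b p t.
Proof.
move=> stu; split=> [u_ok|[s_ok t_ok] j].
  split=> j; move: (u_ok j); have [->] := stu j.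
    by case=> ->; rewrite ?addr0 ?add0r.
  by case=> ->; rewrite ?addr0 ?add0r.
have [-> [->|->]] := stu j; rewrite ?addr0 ?add0r; [exact: t_ok|exact: s_ok].
Qed.

Lemma disjoint_split K s w : (`|s| <= K)%N ->
  disjoint_digits s (b%:Z ^+ K * w) (s + b%:Z ^+ K * w).
Proof.
move=> sK j; rewrite digit_split//; split=> //; rewrite digit_mul//.
by case: (ltnP j K) => jK; [right|left; rewrite digit_small//; lia].
Qed.

Lemma digit_pow i j (c : int) : `|c| <= b./2%:Z ->
  dig j (c * b%:Z ^+ i) = if j == i then c else 0.
Proof.
move=> ch; have := @digit_change b b_odd b_ge5 i j 0 c.
by rewrite !digit0// !add0r; apply.
Qed.

Lemma small_digit (c : int) : `|c| <= 2 -> `|c| <= b./2%:Z.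
Proof. move=> c2; lia. Qed.

Lemma disjoint_change i t (c : int) : `|c| <= 2 -> dig i t = 0 ->
  disjoint_digits t (c * b%:Z ^+ i) (t + c * b%:Z ^+ i).
Proof.
move=> /small_digit c2 ti j; rewrite digit_change ?ti ?add0r// digit_pow//.
by case: eqP => [->|]; rewrite ?ti ?addr0 ?add0r; split=> //; [left|right].
Qed.

Lemma lenv0 : lv 0 = 0.
Proof. by apply/funext => l; rewrite /lenv /= if_same. Qed.

Lemma IPdigit0 p : IPdigit b p 0.
Proof. by move=> j; rewrite digit0. Qed.

Lemma lenv_pow i (c : int) l : c != 0 -> `|c| <= 2 -> (0 < l)%N ->
  lv (c * b%:Z ^+ i) l = `[< D l i.+1 >].
Proof.
move=> c0 /small_digit c2 l0.
rewrite (@lenv_iota (`|c * b%:Z ^+ i| + i.+1)) ?leq_addr// gtn_eqF//.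
rewrite (eq_count (a2 := predI (pred1 i) (fun j => `[< D l j.+1 >]))); last first.
  move=> j; rewrite /digit_in digit_pow//=.
  by case: (eqVneq j i); rewrite ?c0// eqxx.
case: (boolP `[< D l i.+1 >]) => Di.
  rewrite (eq_count (a2 := pred1 i)) ?count_uniq_mem ?iota_uniq ?mem_iota ?addnS //.
    by rewrite /= add0n ltnS leq_addl.
  by move=> j /=; have [->|] := eqVneq j i; rewrite ?Di.
rewrite (eq_count (a2 := pred0)) ?count_pred0// => j /=.
by have [->|//] := eqVneq j i; rewrite (negbTE Di).
Qed.

End LengthVectors.

(** * Realizing vectors as length vectors *)
Section Partition.
Context (b : nat) (b_odd : odd b) (b_ge5 : (5 <= b)%N).
Context (D : nat -> set nat) (D_good : good_partition D).

Local Notation dig := (digit b).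
Local Notation lv := (lenv b D).

(** The minima of the blocks increase strictly, starting at 1 or above. *)
Lemma block_ge l i : (0 < l)%N -> D l i -> (l <= i)%N.
Proof.
have [[Dcover _ D0] _ Dmin] := D_good.
have has_min k : (0 < k)%N -> exists m, is_min (D k) m.
  move=> k0; have /D0[n Dn] : NN k by [].
  have ex : exists n, `[< D k n >] by exists n; apply/asboolP.
  case: (ex_minnP ex) => m /asboolP Dm min_m; exists m; split=> // j Dj.
  by apply: min_m; apply/asboolP.
suff min_ge k m : (0 < k)%N -> is_min (D k) m -> (k <= m)%N.
  move=> l0 Dli; have [m Dm] := has_min l l0.
  exact: leq_trans (min_ge l m l0 Dm) (Dm.2 _ Dli).
elim: k m => // -[|k] IH m _ Dm.
  have : NN m by rewrite -Dcover; exists 1%N => //; exact: Dm.1.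
  by [].
have [m' Dm'] := has_min k.+1 isT.
apply: leq_ltn_trans (IH m' isT Dm') _.
exact: (Dmin k.+1).
Qed.

Lemma lenv_BB t : BB `|t|.+1 (lv t).
Proof.
have sup : supp (lv t) `<=` [set l | (1 <= l <= `|t|)%N].
  move=> l; rewrite /supp /lenv /=; case: (posnP l) => // l0.
  rewrite -lt0n -has_count => /hasP[j].
  rewrite mem_iota add0n => /= jt /andP[_ /asboolP Dj].
  exact: leq_trans (block_ge l0 Dj) jt.
split=> [|l _|l /sup /andP[l1 lt]].
- split=> [|l /sup /andP[]//].
  apply: sub_finite_set (finite_II `|t|.+1) => l /sup /andP[_]; exact.
- rewrite /lenv ltnS; case: eqP => // _.
  by rewrite (leq_trans (count_size _ _)) ?size_iota.
- by apply/andP; split=> //; exact: leqW.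
Qed.

Lemma block_unbounded l n : (0 < l)%N -> exists2 i, (n <= i)%N & D l i.+1.
Proof.
move=> l0; apply: contrapT => no; have [_ Dinf _] := D_good.
apply: (Dinf l l0); apply: sub_finite_set (finite_II n.+1) => -[//|i] Di /=.
by rewrite ltnS ltnNge; apply/negP => ni; apply: no; exists i.
Qed.

(** One unit of the vector is realized at a time, by a digit 1 placed in the
right block beyond all digits used so far; infinite blocks leave room for it,
as well as for making the integer divisible by any given power of the base. *)
Lemma lenv_surj m K : FIN m ->
  exists w, (forall p, IPdigit b p (b%:Z ^+ K * w)) /\ lv (b%:Z ^+ K * w) = m.
Proof.
move=> mF; have [N [_ _ mN]] := FIN_BB mF.
elim: {mF}(\sum_(l < N.+1) m l)%N {-2}m (erefl (\sum_(l < N.+1) m l)%N) mN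
  => [|n IH] {}m mn mN.
  exists 0; rewrite mulr0 lenv0; split=> [p|]; first exact: IPdigit0.
  apply/funext => l; have [//|ml] := eqVneq (m l) 0%N; have /andP[_ lN] := mN l ml.
  move/eqP: mn; rewrite sum_nat_eq0 => /forallP /(_ (inord l)).
  by rewrite inordK ?ltnS//= => /eqP ->.
have [l l0] : exists l : 'I_N.+1, m l != 0%N.
  apply: contrapT => no; move: mn; rewrite big1// => l _.
  by apply/eqP/negP => ml; apply: no; exists l; apply/negP.
pose m' j := if j == l :> nat then (m l).-1 else m j.
have m'n : (\sum_(j < N.+1) m' j = n)%N.
  move: mn; rewrite (bigD1 l)//= => mn.
  rewrite (bigD1 l)//= {1}/m' eqxx (eq_bigr (fun j : 'I_N.+1 => m j)); first lia.
  by move=> j jl; rewrite /m' ifN.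
have [j jm'|w [wp wm']] := IH m' m'n.
  apply: mN; move: jm'; rewrite /supp /= /m'; by case: (eqVneq j l) => // ->.
have /andP[l_gt0 _] := mN l l0.
(* Starting at [K + |b ^ K * w|] keeps the new digit clear of the old ones and
   the sum divisible by [b ^ K]. *)
have [i iK Di] := @block_unbounded l (K + `|b%:Z ^+ K * w|) l_gt0.
have dE : disjoint_digits b (b%:Z ^+ K * w) (1 * b%:Z ^+ i) (b%:Z ^+ K * w + 1 * b%:Z ^+ i).
  by apply: disjoint_change => //; rewrite digit_small//; lia.
exists (w + b%:Z ^+ (i - K)).
have -> : b%:Z ^+ K * (w + b%:Z ^+ (i - K)) = b%:Z ^+ K * w + 1 * b%:Z ^+ i.
  by rewrite mulrDr -exprD subnKC ?mul1r//; lia.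
split=> [p|].
  apply/(IPdigit_disjoint _ dE); split=> // j; rewrite digit_pow//.
    by case: eqP.
  exact: small_digit.
rewrite (lenv_disjoint _ _ _ dE)//; apply/funext => j.
have -> : (lv (b%:Z ^+ K * w) + lv (1 * b%:Z ^+ i)) j = (lv (b%:Z ^+ K * w) j + lv (1 * b%:Z ^+ i) j)%N by [].
rewrite wm' /m'; have [->|jl] := eqVneq.
  by rewrite lenv_pow// asboolT// addn1 prednK// lt0n.
case: (posnP j) => [-> |j0]; first by rewrite /lenv addn0.
rewrite lenv_pow// asboolF ?addn0// => Dj.
have [[_ Dtriv _] _ _] := D_good.
by move/eqP: jl; apply; apply: Dtriv => //; exists i.+1.
Qed.

End Partition.

(** * Digits and the expansions along k *)
Section Expansions.
Context (b : nat) (b_odd : odd b) (b_ge5 : (5 <= b)%N).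
Context (D : nat -> set nat).

Local Notation q := (quot b).
Local Notation dig := (digit b).
Local Notation lv := (lenv b D).

Lemma k_sum (B : nat) (j : int) : (`|j| <= B)%N ->
  k b j = \sum_(i < B) ((j == i.+1%:Z)%:Z - (j == Negz i)%:Z) * b%:Z ^+ i.
Proof.
case: j => [[|n]|n] /= nB; first by rewrite big1// => i _; rewrite mul0r.
- rewrite (bigD1 (Ordinal nB))//= eqxx subr0 mul1r big1 ?addr0// => i ni.
  rewrite (_ : (_ == _) = false) ?mul0r//; apply: contraNF ni => /eqP[ni].
  by apply/eqP/val_inj.
- rewrite (bigD1 (Ordinal nB))//= eqxx sub0r mulN1r big1 ?addr0// => i ni.
  rewrite (_ : (_ == _) = false) ?mul0r//; apply: contraNF ni => /eqP[ni].
  by apply/eqP/val_inj.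
Qed.

(** The coefficient of [b ^ i] in the sum of the [k b j] over [j] in [s]: the
indices [i.+1] and [- i.+1] contribute opposite powers. *)
Definition k_digit (s : seq int) (i : nat) : int :=
  (i.+1%:Z \in s)%:Z - (Negz i \in s)%:Z.

Lemma digit_sum_k (s : seq int) j : uniq s ->
  dig j (\sum_(i <- s) k b i) = k_digit s j.
Proof.
move=> s_uniq.
pose B := (\max_(i <- s) `|i|%N + j.+1)%N.
have sB i : i \in s -> (`|i| <= B)%N.
  by move=> si; apply: leq_trans (leq_addr _ _); exact: (@leq_bigmax_seq _ s xpredT absz).
have mem_sum (a : int) : (a \in s)%:Z = \sum_(i <- s) (i == a)%:Z.
  rewrite -count_uniq_mem//; elim: (s) => [|x r IH]; first by rewrite big_nil.
  by rewrite big_cons /= PoszD IH.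
suff -> : \sum_(i <- s) k b i = \sum_(i < B) k_digit s i * b%:Z ^+ i + b%:Z ^+ B * 0.
  rewrite (@digit_sum _ _ _ (k_digit s))//; first by rewrite /B addnS ltnS leq_addl.
  by move=> i _; apply: small_digit => //; rewrite /k_digit; do 2 case: (_ \in s).
rewrite mulr0 addr0 big_seq (eq_bigr _ (fun i si => k_sum (sB i si))) -big_seq.
rewrite exchange_big; apply: eq_bigr => i _.
by rewrite /k_digit !mem_sum -sumrB mulr_suml.
Qed.

Lemma subset_sums_k (A : set int) t : subset_sums (k b @` A) t ->
  exists s, [/\ uniq s, {in s, forall j, A j} & t = \sum_(j <- s) k b j].
Proof.
move=> [F [/finite_seqP[s0 ->] FA ->]].
pose g x := xget 0 [set n | A n /\ k b n = x].
have gP x : x \in s0 -> A (g x) /\ k b (g x) = x.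
  move=> xs; have [n An nx] := FA x xs.
  by have := @xgetPex _ 0 [set n | A n /\ k b n = x]; apply; exists n.
exists (map g (undup s0)); split=> [|j /mapP[x]|].
- rewrite map_inj_in_uniq ?undup_uniq// => x y; rewrite !mem_undup => xs ys gxy.
  by rewrite -(gP x xs).2 gxy (gP y ys).2.
- by rewrite mem_undup => /gP[+ _] ->.
- have -> : [set` s0] = [set` undup s0] by apply/seteqP; split=> x /=; rewrite mem_undup.
  rewrite -fsbig_seq ?undup_uniq// big_map big_seq [RHS]big_seq.
  by apply: eq_bigr => x; rewrite mem_undup => /gP[].
Qed.

Definition digit_expansion (t : int) : seq int :=
  [seq dig i t * i.+1%:Z | i <- rev (iota 0 `|t|) & dig i t != 0].

Lemma k_digit_index p t i : IPdigit b p t ->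
  k b (dig i t * i.+1%:Z) = dig i t * b%:Z ^+ i.
Proof.
move=> /(_ i); rewrite /ok_digit => /or3P[/eqP->|/eqP->|/andP[_ /eqP->]].
- by rewrite !mul0r.
- by rewrite !mul1r.
- by rewrite !mulN1r.
Qed.

Lemma absz_digit_index p t i : IPdigit b p t -> dig i t != 0 ->
  `|(dig i t * i.+1%:Z)%R|%N = i.+1.
Proof.
move=> /(_ i); rewrite /ok_digit => /or3P[/eqP->//|/eqP->|/andP[_ /eqP->]] _; lia.
Qed.

Lemma sum_digit_expansion p t : IPdigit b p t ->
  t = \sum_(j <- digit_expansion t) k b j.
Proof.
move=> t_ok; rewrite {1}(digit_expand_small b_odd b_ge5 (leqnn `|t|)).
rewrite big_map big_filter (perm_big (iota 0 `|t|)) ?perm_rev//=.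
rewrite -(big_mkord xpredT (fun i => dig i t * b%:Z ^+ i)) /index_iota subn0.
rewrite [RHS]big_mkcond; apply: eq_bigr => i _ /=.
by case: eqP => [->|_]; rewrite ?mul0r// (k_digit_index _ t_ok).
Qed.

Lemma digit_expansionP p t : IPdigit b p t -> is_expansion b t (digit_expansion t).
Proof.
move=> t_ok; split; last exact: sum_digit_expansion t_ok.
- rewrite sorted_map; apply: (@sub_in_sorted _ [pred i | dig i t != 0] gtn).
  + move=> i j /= i0 j0; rewrite !(absz_digit_index t_ok)// ltnS; exact.
  + exact: filter_all.
  + apply: sorted_filter; first by move=> ? ? ? /=; lia.
    by rewrite rev_sorted; exact: iota_ltn_sorted.
- apply/allP => x /mapP[i]; rewrite mem_filter => /andP[i0 _] ->.
  by rewrite (absz_digit_index t_ok).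
Qed.

(** A finite subset of the values of [k] may contain both [b ^ i] and its
opposite; they cancel, and the digits of the sum still lie in {-1, 0, 1}. *)
Lemma IPdigit_IP p t (A : set int) :
  A = (if p then [set n | 0 <= n] else setT) ->
  subset_sums (k b @` A) t <-> IPdigit b p t.
Proof.
move=> AE; split=> [/subset_sums_k[s [s_uniq sA ->]] j|t_ok].
  rewrite digit_sum_k// /k_digit; case: p AE => AE.
    have /negbTE-> : Negz j \notin s by apply/negP => /sA; rewrite AE.
    by case: (_ \in s).
  by do 2 case: (_ \in s).
exists [set` [seq k b j | j <- digit_expansion t]]; split.
- by apply/finite_seqP; eexists.
- move=> x /= /mapP[j /mapP[i] + ->] ->.
  rewrite mem_filter => /andP[i0 _]; exists (dig i t * i.+1%:Z) => //.
  rewrite AE; case: p t_ok {AE} => // /(_ i); rewrite /ok_digit /= orbF (negbTE i0).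
  by move=> /eqP->; rewrite mul1r.
- rewrite -fsbig_seq; first by rewrite big_map -(sum_digit_expansion t_ok).
  rewrite /digit_expansion -map_comp map_inj_in_uniq.
    by rewrite filter_uniq ?rev_uniq ?iota_uniq.
  move=> i j; rewrite !mem_filter => /andP[i0 _] /andP[j0 _] /=.
  rewrite !(k_digit_index _ t_ok) => /(congr1 (dig i)).
  rewrite !digit_pow ?digit_bound// eqxx; case: eqP => // _ di0.
  by rewrite di0 eqxx in i0.
Qed.

Lemma IP_digit t : IP b t <-> IPdigit b false t.
Proof. exact: (@IPdigit_IP false). Qed.

Lemma IP_plus_digit t : IP_plus b t <-> IPdigit b true t.
Proof. exact: (@IPdigit_IP true). Qed.

(** Uniqueness of expansions enters here: whatever expansion is chosen, the
absolute values of its indices are the positions of the nonzero digits. *)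
Lemma length_vector_lenv p t : IPdigit b p t -> length_vector b D t = lv t.
Proof.
move=> t_ok; apply/funext => l; rewrite /length_vector /lenv; case: eqP => // _.
have [] : is_expansion b t (expansion b t).
  have := @xgetPex _ [::] [set s | is_expansion b t s]; apply.
  by exists (digit_expansion t); exact: digit_expansionP t_ok.
set s := expansion b t => s_sorted s_gt0 tE.
have s_abs : uniq (map absz s).
  apply: (@sorted_uniq _ gtn) => [? ? ?|?|] /=; [lia|lia|by rewrite sorted_map].
have s_uniq := map_uniq s_abs.
rewrite -(count_map absz (fun j => `[< D l j >])).
have -> : count (digit_in b D l t) (iota 0 `|t|) =
    count (fun j => `[< D l j >]) (map S [seq i <- iota 0 `|t| | dig i t != 0]).
  by rewrite count_map count_filter; apply: eq_count => i; rewrite /digit_in/= andbC.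
apply/permP/uniq_perm => //; first by rewrite map_inj_uniq ?filter_uniq ?iota_uniq// => ? ? [].
have abs_inj : {in s &, injective absz}.
  elim: (s) s_abs => //= a r IH /andP[ar /IH{}IH] x y; rewrite !inE.
  move=> /orP[/eqP->|xr] /orP[/eqP->|yr] // xy; last exact: IH.
    by move: ar; rewrite xy map_f.
  by move: ar; rewrite -xy map_f.
have dig_s i : (dig i t != 0) = (i.+1 \in map absz s).
  rewrite tE digit_sum_k// /k_digit; apply/idP/mapP => [|[j js ij]].
    have [si _|_] := boolP (i.+1%:Z \in s); first by exists i.+1%:Z.
    by have [si _|//] := boolP (Negz i \in s); exists (Negz i).
  have : j = i.+1%:Z \/ j = Negz i by lia.
  move=> [] jE; rewrite jE in js; rewrite js.
    have [si|//] := boolP (Negz i \in s).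
    by have := abs_inj _ _ js si erefl.
  have [si|//] := boolP (i.+1%:Z \in s).
  by have := abs_inj _ _ js si erefl.
move=> n; apply/idP/mapP => [ns|[i + ->]]; last by rewrite mem_filter dig_s => /andP[].
have : (0 < n)%N by case/mapP: ns => j js ->; exact: (allP s_gt0).
case: n ns => // n ns _; exists n => //; rewrite mem_filter dig_s ns mem_iota/=.
rewrite add0n ltnNge; apply/negP => tn; move: ns; rewrite -dig_s digit_small//.
Qed.

End Expansions.

(** * Closures in the shift space and in the space of labels *)
Definition window (L : nat) (y : shift_space) : set shift_space :=
  [set g | forall t : int, (`|t| <= L)%N -> g t = y t].

Lemma window_nbhs L (y : shift_space) : nbhs y (window L y).
Proof.
have near_coord (t : int) : nbhs y [set g : shift_space | g t = y t].
  have /cvg_sup/(_ t)/cvg_image : nbhs y --> y by exact: cvg_id.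
  have surj : (fun f : int -> bool => f t) @` setT = setT.
    by rewrite eqEsubset; split=> // v _; exists (fun=> v).
  move=> /(_ surj) /(_ [set y t]).
  have yt : nbhs (y t) [set y t] by rewrite nbhs_principalE; apply/principal_filterP.
  move=> /(_ yt) [W yW WE]; apply: filterS yW => g Wg /=.
  have : [set f t | f in W] (g t) by exists g.
  by rewrite WE.
have [s sP] : exists s : seq int, forall t, (t \in s) = (`|t| <= L)%N.
  exists ([seq n%:Z | n <- iota 0 L.+1] ++ [seq - n%:Z | n <- iota 0 L.+1]).
  move=> t; rewrite mem_cat; apply/orP/idP => [[] /mapP[n]|tL].
  - by rewrite mem_iota => nL ->; lia.
  - by rewrite mem_iota => nL ->; lia.
  - case: (lerP 0 t) => t0; [left|right]; apply/mapP; exists `|t|%N;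
      by rewrite ?mem_iota; lia.
suff : nbhs y [set g : shift_space | {in s, forall t, g t = y t}].
  by apply: filterS => g gy t tL; apply: gy; rewrite sP.
elim: s {sP} => [|t s IH]; first by apply: filterE => g t.
apply: filterS2 (near_coord t) IH => g gt gs t'.
by rewrite inE => /orP[/eqP->|/gs].
Qed.

Lemma nbhs_window (y : shift_space) U : nbhs y U -> exists L, window L y `<=` U.
Proof.
pose F : set_system shift_space := filter_from setT (window^~ y).
have F_filter : Filter F.
  apply: filter_from_filter; first by exists 0%N.
  move=> i j _ _; exists (maxn i j) => // g gy.
  by split=> t tL; apply: gy; lia.
suff Fy : F --> y by move=> /Fy [L _ LU]; exists L.
apply/cvg_sup => t; apply/cvg_image.
  by rewrite eqEsubset; split=> // v _; exists (fun=> v).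
move=> V Vy; exists ((fun f : shift_space => f t) @^-1` V).
  exists `|t|%N => // g gy /=; rewrite gy//; exact: nbhs_singleton.
by rewrite eqEsubset; split=> [v [f + <-]//|v Vv]; exists (fun=> v).
Qed.

Lemma closure_windowP (G : set shift_space) y :
  closure G y <-> forall L, exists2 g, G g & window L y g.
Proof.
split=> [Gy L|Gy U /nbhs_window[L LU]].
  by have [g [Gg yg]] := Gy _ (window_nbhs L y); exists g.
by have [g Gg yg] := Gy L; exists g; split=> //; exact: LU.
Qed.

Lemma closure_agreeP (Psi : set LAB) M :
  closure Psi M <-> forall N, exists2 M', Psi M' & agree M M' N.
Proof.
split=> [PM N|PM U].
  have e0 : 0 < (2 ^- N : Rdefinitions.R) by rewrite invr_gt0 exprn_gt0.
  have [M' [PM' MM']] := PM _ (nbhsx_ballx M _ e0); exists M' => //.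
  move: MM'; rewrite ballEmdist /= => /LAB_dist_lt[K aK].
  rewrite ltf_pV2 ?posrE ?exprn_gt0// ltr_eXn2l ?ltr1n// => NK.
  exact: agree_le (ltnW NK) aK.
move=> /nbhs_ballP[e /= e0 eU].
have [N _ /(_ N (leqnn N)) /= ltN] :=
  @near_infty_natSinv_expn_lt Rdefinitions.R (PosNum e0).
rewrite div1r in ltN.
have [M' PM' MM'] := PM N; exists M'; split=> //; apply: eU.
by rewrite ballEmdist /=; apply: le_lt_trans ltN; exact: LAB_dist_le.
Qed.

Lemma FIN_le (m1 m : nat -> nat) : (m1 <= m)%O -> FIN m -> FIN m1.
Proof.
move=> /lefP m1m [m_fin m_supp].
have sub : supp m1 `<=` supp m.
  by move=> l; rewrite /supp /= -!lt0n => /leq_trans; apply; exact: m1m.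
by split; [exact: sub_finite_set m_fin | exact: subset_trans m_supp].
Qed.

(** The defining property of a label asks for membership of the smaller vector
in [FIN], which follows from the inequality. *)
Lemma label_le (M : LAB) (m1 m : nat -> nat) :
  (m1 <= m)%O -> label_set M m -> label_set M m1.
Proof.
move=> m1m Mm; apply: ((labelP M).2 m1 m _ m1m Mm).
exact: FIN_le m1m ((labelP M).1 _ Mm).
Qed.

Lemma label_FIN (M : LAB) m : label_set M m -> FIN m.
Proof. exact: (labelP M).1. Qed.

Lemma BB_finite N : finite_set (BB N).
Proof.
pose f (g : {ffun 'I_N.+1 -> 'I_N.+1}) (l : nat) : nat :=
  if (l <= N)%N then g (inord l) : nat else 0%N.
apply: (@sub_finite_set _ _ (f @` setT)); last exact/finite_image/finite_finset.
move=> m [mF mN ms]; exists [ffun l : 'I_N.+1 => inord (m l)] => //.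
apply/funext => l; rewrite /f; case: leqP => lN.
  rewrite ffunE (@inordK _ l)//; have [->|l0] := posnP l; last first.
    by rewrite inordK// ltnS ltnW// mN.
  have [->|m0] := eqVneq (m 0%N) 0%N; first by rewrite inordK.
  by have := ms 0%N m0.
by apply/esym; have [//|ml] := eqVneq (m l) 0%N; have /andP[_] := ms l ml; rewrite leqNgt lN.
Qed.

Lemma finite_ub (T : eqType) (A : set T) (f : T -> nat) : finite_set A ->
  exists L, forall x, A x -> (f x <= L)%N.
Proof.
move=> /finite_seqP[s ->]; exists (\max_(x <- s) f x)%N => x xs.
exact: (@leq_bigmax_seq _ s xpredT f).
Qed.

(** Invariance is an equality of sets, hence also gives the inverse shift. *)
Lemma S_invariantP (Y : set shift_space) :
  S_invariant Y <-> forall n y, Y y -> Y (Siter n y).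
Proof.
have SiterD n m y : Siter n (Siter m y) = Siter (n + m) y.
  by apply/funext => t; rewrite /Siter addrA.
have Siter0 y : Siter 0 y = y by apply/funext => t; rewrite /Siter addr0.
split=> [Yinv|Yinv]; last first.
  apply/seteqP; split=> [_ [y Yy <-]|y Yy]; first exact: Yinv.
  by exists (Siter (-1) y); [exact: Yinv|rewrite /Sshift SiterD subrr Siter0].
have up y : Y y -> Y (Siter 1 y) by move=> Yy; rewrite -Yinv; exists y.
have down y : Y y -> Y (Siter (-1) y).
  by rewrite -{1}Yinv => -[z Yz <-]; rewrite /Sshift SiterD addNr Siter0.
move=> [] n y Yy.
  elim: n => [|n IH]; first by rewrite Siter0.
  by rewrite intS -SiterD; exact: up.
elim: n => [|n IH]; first exact: down.
by rewrite (_ : Negz n.+1 = -1 + Negz n) -?SiterD; [exact: down|lia].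
Qed.

Definition orbits (G : set shift_space) : set shift_space :=
  [set z | exists n, exists2 g, G g & z = Siter n g].

Lemma closure_orbits_closed_invariant G :
  closed (closure (orbits G)) /\ S_invariant (closure (orbits G)).
Proof.
split; first exact: closed_closure.
apply/S_invariantP => n y /closure_windowP yG; apply/closure_windowP => L.
have [_ [m [g Gg ->]] yg] := yG (L + `|n|)%N.
exists (Siter (n + m) g); first by exists (n + m), g.
by move=> t tL; rewrite /Siter addrA -yg//; lia.
Qed.

Lemma generated_subshiftE G : generated_subshift G = closure (orbits G).
Proof.
apply/seteqP; split.
  apply: smallest_sub; first exact: closure_orbits_closed_invariant.
  move=> g Gg; apply: subset_closure; exists 0, g => //.
  by apply/funext => t; rewrite /Siter addr0.
move=> y Gy Y [[Ycl Yinv] GY]; rewrite (closure_id Y).1//.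
apply: closureS Gy => _ [n [g Gg ->]].
by move/S_invariantP : Yinv; apply; exact: GY.
Qed.

Lemma orbit_closureE x : orbit_closure x = generated_subshift [set x].
Proof.
rewrite generated_subshiftE; congr closure; apply/seteqP; split=> z.
  by move=> [n _ <-]; exists n, x.
by move=> [n [g -> ->]]; exists n.
Qed.

(** * The empty label and labels of finite type *)
Lemma agreeP (N N' : LAB) K m : agree N N' K -> BB K m ->
  label_set N m <-> label_set N' m.
Proof.
move=> NN' Km; split=> Nm.
  by have : (label_set N `&` BB K) m by []; rewrite NN' => -[].
by have : (label_set N' `&` BB K) m by []; rewrite -NN' => -[].
Qed.

Lemma empty_is_label : is_label set0.
Proof. by split=> // m1 m _ _ []. Qed.

Definition empty_label : LAB := Label empty_is_label.

Lemma label_emptyP (N : LAB) : N = empty_label \/ label_set N 0.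
Proof.
have [N0|] := EM (label_set N 0); first by right.
move=> N0; left; apply: LAB_eq; rewrite /= -subset0 => m Nm; apply: N0.
by apply: label_le Nm; apply/lefP => l; rewrite leEnat.
Qed.

Lemma shift_label_empty (M : LAB) r : ~ label_set M r ->
  shift_label r M = empty_label.
Proof.
move=> Mr; apply: LAB_eq; rewrite /= -subset0 => m [_ Mmr]; apply: Mr.
by apply: label_le Mmr; apply/lefP => l; rewrite leEnat; exact: leq_addl.
Qed.

(** Otherwise the multiples of the first unit vector would form an infinite
strictly increasing sequence in [M]. *)
Lemma finite_type_proper (M : LAB) : finite_type M -> exists2 r, FIN r & ~ label_set M r.
Proof.
move=> Mfin; apply: contrapT => allM; apply: Mfin.
exists (fun n l => if l == 1%N then n else 0%N); split=> [_ [n _ <-]|n].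
  apply: contrapT => Mn; apply: allM; eexists; last exact: Mn.
  have sub : supp (fun l => if l == 1%N then n else 0%N) `<=` [set 1%N].
    by move=> l; rewrite /supp /=; have [|] := eqVneq l 1%N.
  by split; [exact: sub_finite_set sub _|move=> l /sub ->].
rewrite lt_neqAle; apply/andP; split; last first.
  by apply/lefP => l; case: eqP => // _; exact: leqnSn.
by apply/eqP => /(congr1 (fun f => f 1%N)) /= /n_Sn.
Qed.

(** * The points attached to labels *)

(** The common form of [xlab] (for [p = false]) and [xlab_plus] (for
[p = true]). *)
Definition xdigit (b : nat) (D : nat -> set nat) (p : bool) (M : LAB) : shift_space :=
  charfun [set t | IPdigit b p t /\ label_set M (lenv b D t)].

Section LabelPoints.
Context (b : nat) (b_odd : odd b) (b_ge5 : (5 <= b)%N).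
Context (D : nat -> set nat) (D_good : good_partition D) (p : bool).

Local Notation q := (quot b).
Local Notation dig := (digit b).
Local Notation lv := (lenv b D).
Local Notation x := (xdigit b D p).
Local Notation IPp := (IPdigit b p).

Lemma xdigitP M t : x M t <-> IPp t /\ label_set M (lv t).
Proof. by split=> [/asboolP//|?]; apply/asboolP. Qed.

Lemma bool_iff_eq (c d : bool) : (c <-> d) -> c = d.
Proof. by case: c d => [] [] // [cd dc]; [have := cd isT|have := dc isT]. Qed.

Lemma disjoint_low J s n : (`|s| <= J)%N -> (forall j, (j < J)%N -> dig j n = 0) ->
  disjoint_digits b s n (s + n).
Proof. by move=> sJ n0; rewrite (digit_dvd n0); exact: disjoint_split. Qed.

Lemma xdigit_add M J s n : (`|s| <= J)%N ->
  (forall j, (j < J)%N -> dig j n = 0) -> IPp n ->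
  x M (s + n) <-> IPp s /\ label_set M (lv s + lv n).
Proof.
move=> sJ n0 n_ok; have dis := disjoint_low sJ n0.
rewrite xdigitP (IPdigit_disjoint p dis) (lenv_disjoint b_odd b_ge5 D dis).
by split=> [[[? _] ?]|[? ?]].
Qed.

Lemma drop_digit M n i : x M n -> x M (- dig i n * b%:Z ^+ i + n).
Proof.
move=> /xdigitP[n_ok Mn]; rewrite addrC.
have dE j : dig j (n + - dig i n * b%:Z ^+ i) = if j == i then 0 else dig j n.
  by rewrite digit_change ?subrr// normr0.
apply/xdigitP; split=> [j|]; first by rewrite dE; case: ifP.
apply: label_le Mn; apply: lenv_le => // j; rewrite dE.
by have [_|] := eqVneq j i.
Qed.

Lemma ok_digit_le1 (e : int) : ok_digit p e -> `|e| <= 1.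
Proof. by case/or3P => [/eqP->|/eqP->|/andP[_ /eqP->]]. Qed.

(** A nonzero digit [e] of [n] in position [j] can be erased, so [- e * b ^ j]
is seen in [x N]; the length vector ignores signs, so [e * b ^ j] is seen too,
and then [e] could be added once more to [n], giving the digit [2 e]. *)
Lemma low_digit_eq0 N N' n L j : label_set N 0 ->
  (forall t, (`|t| <= L)%N -> x N t = x N' (t + n)) -> (b ^ j <= L)%N ->
  dig j n = 0.
Proof.
move=> N0 NN' jL; apply/eqP/negPn/negP => e0; set e := dig j n in e0.
have xn : x N' n.
  rewrite -[n]add0r -NN'//; apply/xdigitP; split; first exact: IPdigit0.
  by rewrite lenv0.
have e_ok : ok_digit p e by have /xdigitP[n_ok _] := xn; exact: n_ok.
have e1 := ok_digit_le1 e_ok.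
have normL (c : int) : `|c| <= 1 -> (`|(c * b%:Z ^+ j)%R| <= L)%N.
  move=> c1; apply: leq_trans jL; rewrite abszM abszX /= -[X in (_ <= X)%N]mul1n leq_mul2r.
  by apply/orP; right; lia.
have : x N (- e * b%:Z ^+ j).
  by rewrite NN' ?normL ?normrN//; exact: drop_digit.
move=> /xdigitP[_ Ne].
have eL : `|e| <= b./2%:Z by apply: small_digit => //; lia.
have NeL : `|- e| <= b./2%:Z by rewrite normrN.
have : x N (e * b%:Z ^+ j).
  apply/xdigitP; split=> [i|]; first by rewrite digit_pow//; case: eqP.
  rewrite (@lenv_eq _ b_odd b_ge5 D _ (- e * b%:Z ^+ j))// => i.
  by rewrite !digit_pow//; case: (i == j); rewrite ?oppr_eq0.
rewrite NN' ?normL// addrC => /xdigitP[/(_ j) + _].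
rewrite digit_change -/e ?eqxx//; last by apply: small_digit => //; lia.
(* The digit is now [e + e], hence 2 or -2. *)
move: e0; case/or3P: e_ok => [/eqP->|/eqP->|/andP[_ /eqP->]] //= _;
  by rewrite /ok_digit /= ?andbF.
Qed.

(** The window is chosen so large that it contains a realization of every
vector of [BB K] and kills all digits of the translation [n] that could
interact with these realizations; then [N] and [N' - r(n)] agree on [BB K]. *)
Lemma label_of_limit_point (Psi : set LAB) N : label_set N 0 ->
  closure (orbits (x @` Psi)) (x N) ->
  closure [set shift_label r N' | N' in Psi & r in FIN] N.
Proof.
move=> N0 /closure_windowP xN; apply/closure_agreeP => K.
have /choice[g gP] m : exists t, FIN m -> IPp t /\ lv t = m.
  have [mF|nF] := EM (FIN m); last by exists 0.
  have [w [w_ok wm]] := lenv_surj b_odd b_ge5 D_good 0 mF.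
  by exists (b%:Z ^+ 0 * w).
have [J JP] := finite_ub (absz \o g) (BB_finite K).
(* [J] accommodates the realizations, [b ^ J] the powers used to show that the
   digits of [n] below [J] vanish. *)
have [_ [n [_ [N' PN' <-] ->]] xNn] := xN (J + b ^ J)%N.
have {}xNn t : (`|t| <= J + b ^ J)%N -> x N t = x N' (t + n) by move=> /xNn <-.
have n0 j : (j < J)%N -> dig j n = 0.
  move=> jJ; apply: (low_digit_eq0 N0 xNn).
  have bj : (b ^ j <= b ^ J)%N by apply: leq_pexp2l; [lia|exact: ltnW].
  exact: leq_trans bj (leq_addl _ _).
have : x N' n.
  rewrite -[n]add0r -xNn//; apply/xdigitP; split; first exact: IPdigit0.
  by rewrite lenv0.
move=> /xdigitP[n_ok N'n].
exists (shift_label (lv n) N'); first by exists N' => //; exists (lv n) => //; exact: label_FIN N'n.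
have mP m : BB K m -> label_set N m <-> label_set N' (m + lv n).
  move=> Km; have [mF _ _] := Km; have [g_ok gm] := gP m mF.
  have gJ : (`|g m| <= J)%N := JP m Km.
  have := xdigit_add N' gJ n0 n_ok; rewrite -xNn ?(leq_trans gJ) ?leq_addr//.
  by rewrite xdigitP gm => -[NN' N'N]; split=> [Nm|N'm]; [have [] := NN' (conj g_ok Nm)|have [] := N'N (conj g_ok N'm)].
rewrite /agree /=; apply/seteqP; split=> m [Nm Km]; split=> //.
  by split; [case: Km|exact/mP].
by apply/mP => //; case: Nm.
Qed.

(** Realize [r] by integers divisible by high powers of the base and translate
by them. *)
Lemma shift_label_point N r : FIN r ->
  generated_subshift [set x N] (x (shift_label r N)).
Proof.
move=> rF; rewrite generated_subshiftE; apply/closure_windowP => L.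
have [w [w_ok wr]] := lenv_surj b_odd b_ge5 D_good L rF.
set v := b%:Z ^+ L * w in w_ok wr.
exists (Siter v (x N)); first by exists v, (x N).
move=> t tL; apply: bool_iff_eq; rewrite /Siter (@xdigit_add _ L)//; last first.
  by move=> j jL; rewrite digit_mul// jL.
rewrite xdigitP wr /=; split=> [[t_ok Nt]|[t_ok []//]]; split=> //; split=> //.
by have [] := lenv_BB b D_good t.
Qed.

Definition points_in (Y : set shift_space) : set LAB := [set N | Y (x N)].

(** The value of [x N] at [t] depends only on whether [N] contains the length
vector of [t], which lies in [BB `|t|.+1]: the map [x] is continuous. *)
Lemma closed_points_in Y : closed Y -> closed (points_in Y).
Proof.
move=> Ycl N /closure_agreeP YN; rewrite /points_in /=; apply: Ycl.
apply/closure_windowP => L; have [N' YN' NN'] := YN L.+1.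
exists (x N') => // t tL; apply: bool_iff_eq; rewrite !xdigitP.
have tB : BB L.+1 (lv t) by apply: BB_sub (lenv_BB b D_good t).
by have := agreeP NN' tB; tauto.
Qed.

Lemma generated_subshift_min G Y : closed Y -> S_invariant Y -> G `<=` Y ->
  generated_subshift G `<=` Y.
Proof. by move=> ? ? ?; apply: smallest_sub. Qed.

Lemma FIN_invariant_points_in Y : closed Y -> S_invariant Y ->
  FIN_invariant (points_in Y).
Proof.
move=> Ycl Yinv r rF _ [N YN <-].
apply: (@generated_subshift_min [set x N] Y) => //; first by move=> _ ->.
exact: shift_label_point.
Qed.

Lemma generated_closed G : closed (generated_subshift G).
Proof. by rewrite generated_subshiftE; case: (closure_orbits_closed_invariant G). Qed.

Lemma generated_S_invariant G : S_invariant (generated_subshift G).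
Proof. by rewrite generated_subshiftE; case: (closure_orbits_closed_invariant G). Qed.

Lemma Theta_points M : Theta M `<=` points_in (orbit_closure (x M)).
Proof.
rewrite orbit_closureE.
have /closure_id -> := closed_points_in (@generated_closed [set x M]).
by apply: closureS => _ [r rF <-]; exact: shift_label_point.
Qed.

(** The limit [z] sees an integer [s] according to whether [M] contains
[lv s + lv v], which is a monotone condition on [lv s]; so the length vectors
of the integers seen by [z] form a label, and [z] is its point. *)
Lemma limit_along_powers M z :
  (forall K, exists v, [/\ IPp v, (forall j, (j < K)%N -> dig j v = 0) &
     forall t, (`|t| <= K)%N -> z t = x M (t + v)]) ->
  exists N, z = x N.
Proof.
move=> zM.
have zle s s' : z s -> IPp s' -> (lv s' <= lv s)%O -> z s'.
  move=> zs s'_ok ss'; have [v [v_ok v0 zv]] := zM (`|s| + `|s'|)%N.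
  move: zs; rewrite !zv ?leq_addr ?leq_addl//.
  rewrite (xdigit_add _ _ v0)// ?leq_addr// => -[s_ok Ms].
  apply/(xdigit_add _ _ v0) => //; first exact: leq_addl.
  split=> //; apply: label_le Ms; apply/lefP => l; rewrite leEnat.
  by apply: leq_add => //; exact: (lefP _ _ ss' l).
pose N : set (nat -> nat) := [set m | FIN m /\ exists s, [/\ IPp s, lv s = m & z s]].
have N_label : is_label N.
  split=> [m []//|m1 m m1F m1m [mF [s [s_ok sm zs]]]]; split=> //.
  have [w [w_ok wm]] := lenv_surj b_odd b_ge5 D_good 0 m1F.
  by exists (b%:Z ^+ 0 * w); split=> //; apply: zle zs _ _ => //; rewrite wm sm.
exists (Label N_label); apply/funext => s; apply: bool_iff_eq; rewrite xdigitP /=.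
split=> [zs|[s_ok [_ [s' [s'_ok s's zs']]]]]; last by apply: zle zs' _ _; rewrite ?s's.
have [v [v_ok v0 zv]] := zM `|s|%N.
have s_ok : IPp s by move: (zs); rewrite zv// (xdigit_add _ _ v0)// => -[].
split=> //; split; last by exists s.
by have [] := lenv_BB b D_good s.
Qed.

End LabelPoints.

(** * The correspondence between label sets and subshifts *)
Section Correspondence.
Context (b : nat) (b_odd : odd b) (b_ge5 : (5 <= b)%N).
Context (D : nat -> set nat) (D_good : good_partition D) (p : bool).

Local Notation q := (quot b).
Local Notation dig := (digit b).
Local Notation lv := (lenv b D).
Local Notation x := (xdigit b D p).
Local Notation IPp := (IPdigit b p).

(** The digit [j] of [n], read off the point [z] that shows [x M] around [n].
The integer [n - b ^ j] is in the set when the digit is 1, and [n + b ^ j] when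
it is -1; when the digit is 0 the two have the same length vector, so both or
neither are seen and the difference vanishes.  Without the digit -1, the second
term is dropped and [n - b ^ j] is seen exactly when the digit is 1. *)
Definition window_digit (z : shift_space) (j : nat) : int :=
  (z (- b%:Z ^+ j))%:Z - (~~ p && z (b%:Z ^+ j))%:Z.

Lemma window_digitP M (z : shift_space) L n j : z 0 ->
  (forall t, (`|t| <= L)%N -> z t = x M (t + n)) -> (b ^ j <= L)%N ->
  dig j n = window_digit z j.
Proof.
move=> z0 zn jL.
have xn : x M n by rewrite -[n]add0r -zn.
have /(xdigitP) [n_ok Mn] := xn.
have bL : (`|b%:Z ^+ j| <= L)%N by rewrite abszX.
rewrite /window_digit !zn ?abszN// ![_ + n]addrC.
have changeE (c : int) : `|dig j n + c| <= 2 -> forall i,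
    dig i (n + c * b%:Z ^+ j) = if i == j then dig j n + c else dig i n.
  by move=> c2 i; apply: digit_change => //; exact: small_digit.
have minusE : n - b%:Z ^+ j = n + (-1) * b%:Z ^+ j by rewrite mulN1r.
have plusE : n + b%:Z ^+ j = n + 1 * b%:Z ^+ j by rewrite mul1r.
have bad (c : int) : `|dig j n + c| <= 2 -> ~~ ok_digit p (dig j n + c) ->
    x M (n + c * b%:Z ^+ j) = false.
  move=> c2 /negP bad; apply/negP => /xdigitP[/(_ j)].
  by rewrite changeE// eqxx.
have drop := drop_digit b_odd b_ge5 j xn; rewrite addrC in drop.
have := n_ok j; rewrite /ok_digit => /or3P[/eqP d|/eqP d|/andP[pF /eqP d]].
- rewrite d; have /orP[pT|pF] := orbN p.
    by rewrite minusE bad ?d// /ok_digit pT.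
  rewrite minusE plusE pF /=.
  suff -> : x M (n + (-1) * b%:Z ^+ j) = x M (n + 1 * b%:Z ^+ j) by rewrite subrr.
  apply: bool_iff_eq; rewrite !xdigitP.
  have -> : lv (n + 1 * b%:Z ^+ j) = lv (n + (-1) * b%:Z ^+ j).
    by apply: lenv_eq => // i; rewrite !changeE ?d//; case: (i == j).
  split=> -[_ ?]; split=> // i; rewrite changeE ?d//; case: (i == j) => //;
    by rewrite /ok_digit pF.
- rewrite d mulN1r in drop *; rewrite drop plusE bad ?d//; first by rewrite andbF.
  by rewrite /ok_digit /= andbF.
- rewrite d opprK mul1r in drop *; rewrite drop pF minusE bad ?d//.
  by rewrite /ok_digit /= andbF.
Qed.

(** After translating [y] so that 0 is seen, the digits [e] it dictates have
truncations [u J] with length vectors in [M]; these grow strictly at every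
nonzero [e j], so finite type makes [e] eventually zero, and what remains after
translating by the final [u J] is a limit along high powers of the base. *)
Lemma finite_type_limit M (y : shift_space) a : finite_type M ->
  generated_subshift [set x M] y -> y a ->
  exists u N, y = Siter u (x N).
Proof.
move=> Mfin My ya; pose z := Siter a y.
have z0 : z 0 by rewrite /z /Siter add0r.
have win L : exists n, forall t, (`|t| <= L)%N -> z t = x M (t + n).
  have : generated_subshift [set x M] z.
    have /S_invariantP := @generated_S_invariant [set x M]; exact.
  rewrite generated_subshiftE => /closure_windowP /(_ L)[_ [n [_ -> ->]] zn].
  by exists n => t /zn <-.
pose e := window_digit z; pose u J := \sum_(i < J) e i * b%:Z ^+ i.
have eP L n j : (forall t, (`|t| <= L)%N -> z t = x M (t + n)) ->
    (b ^ j <= L)%N -> dig j n = e j by move=> zn; exact: (window_digitP z0 zn).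
have xn L n : (forall t, (`|t| <= L)%N -> z t = x M (t + n)) -> x M n.
  by move=> zn; rewrite -[n]add0r -zn.
have pow_le i J : (i <= J)%N -> (b ^ i <= b ^ J)%N by apply: leq_pexp2l; lia.
have e_bound j : `|e j| <= b./2%:Z.
  by have [n zn] := win (b ^ j)%N; rewrite -(eP _ _ _ zn)//; exact: digit_bound.
have dig_u J j : dig j (u J) = if (j < J)%N then e j else 0.
  have := @digit_sum b b_odd b_ge5 e 0 J (fun i _ => e_bound i) j.
  by rewrite mulr0 addr0 digit0.
have uM J : label_set M (lv (u J)).
  have [n zn] := win (b ^ J)%N; have /xdigitP[_ Mn] := xn _ _ zn.
  apply: label_le Mn; apply: lenv_le => // j; rewrite dig_u; case: ltnP => // jJ.
  by rewrite -(eP _ _ _ zn)//; exact: pow_le (ltnW jJ).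
(* The digit [e j] adds one unit to the block containing [j.+1]. *)
have u_lt J j : (J <= j)%N -> e j != 0 -> (lv (u J) < lv (u j.+1))%O.
  move=> Jj ej; pose t := u J + e j * b%:Z ^+ j.
  have dis : disjoint_digits b (u J) (e j * b%:Z ^+ j) t.
    have uj : dig j (u J) = 0 by rewrite dig_u ltnNge Jj.
    move=> i; rewrite /t digit_change ?uj ?add0r// digit_pow//.
    have [->|_] := eqVneq i j; first by rewrite uj add0r; split=> //; left.
    by rewrite addr0; split=> //; right.
  have tu : (lv t <= lv (u j.+1))%O.
    apply: lenv_le => // i; have [-> _] := dis i; rewrite !dig_u digit_pow//.
    have [->|ij] := eqVneq i j; first by rewrite ltnSn.
    case: ltnP => // iJ; rewrite addr0 ifT//; lia.
  have [[Dcover _ _] _ _] := D_good.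
  have [l l0 Dl] : cover NN D j.+1 by rewrite Dcover.
  apply: lt_le_trans tu; rewrite (lenv_disjoint b_odd b_ge5 D dis).
  rewrite lt_neqAle; apply/andP; split; last first.
    by apply/lefP => i; rewrite leEnat; exact: leq_addr.
  apply/eqP => /(congr1 (fun f => f l)).
  have -> : (lv (u J) + lv (e j * b%:Z ^+ j)) l =
      (lv (u J) l + lv (e j * b%:Z ^+ j) l)%N by [].
  have e2 : `|e j| <= 2.
    have [n zn] := win (b ^ j)%N; rewrite -(eP _ _ _ zn)//.
    have /xdigitP[/(_ j) /ok_digit_le1 + _] := xn _ _ zn; lia.
  by rewrite lenv_pow// asboolT//; lia.
have [J eJ] : exists J, forall j, (J <= j)%N -> e j = 0.
  apply: contrapT => e_inf; apply: Mfin.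
  have /choice[f fP] J : exists j, (J <= j)%N /\ e j != 0.
    apply: contrapT => no; apply: e_inf; exists J => j Jj.
    by apply/eqP/negPn/negP => ej; apply: no; exists j.
  exists (fun n => lv (u (iter n (fun J => (f J).+1) 0%N))).
  split=> [_ [n _ <-]//|n]; have [? ?] := fP (iter n (fun J => (f J).+1) 0%N).
  exact: u_lt.
have uJ K : u (J + K)%N = u J.
  rewrite /u big_split_ord /= [X in _ + X]big1 ?addr0// => i _.
  by rewrite eJ ?mul0r// leq_addr.
(* Beyond [J] the digits of [n] visible in the window are zero, so [n - u J] is
   divisible by a high power of [b]. *)
have [|N zN] := @limit_along_powers b b_odd b_ge5 D D_good p M (Siter (- u J) z).
  move=> K; have [n zn] := win (b ^ (J + K) + K + `|u J|)%N.
  have dig_n i : (i < J + K)%N -> dig i n = e i.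
    move=> iK; apply: eP zn _; apply: leq_trans (pow_le _ _ (ltnW iK)) _.
    by rewrite -addnA leq_addr.
  pose v := b%:Z ^+ (J + K) * iter (J + K) q n.
  have nE : n = u J + v.
    rewrite {1}(digit_expand b (J + K) n) -(uJ K); congr (_ + _).
    by apply: eq_bigr => i _; rewrite dig_n.
  have dig_v i : dig i v = if (i < J + K)%N then 0 else dig i n.
    by rewrite digit_mul// digit_iter; case: ltnP => // /subnKC ->.
  exists v; split=> [i|i iK|t tK].
  - by have /xdigitP[/(_ i) n_ok _] := xn _ _ zn; rewrite dig_v; case: ifP.
  - by rewrite dig_v ifT//; lia.
  - by rewrite /Siter zn; [rewrite nE addrA subrK|lia].
exists (u J - a), N; rewrite -zN /z; apply/funext => t.
by rewrite /Siter; congr y; lia.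
Qed.

Local Notation XX Psi := (generated_subshift (x @` Psi)).

Lemma points_in_generated Psi N : closed Psi -> FIN_invariant Psi ->
  label_set N 0 -> points_in b D p (XX Psi) N -> Psi N.
Proof.
move=> Psi_cl Psi_inv N0; rewrite /points_in /= generated_subshiftE.
move=> /(label_of_limit_point b_odd b_ge5 D_good N0) cl; apply: Psi_cl.
apply: closureS cl => _ [N' PN' [r rF <-]].
by apply: (Psi_inv r rF); exists N'.
Qed.

Lemma generated_point (Psi : set LAB) N : Psi N -> XX Psi (x N).
Proof. by move=> PN; apply: sub_gen_smallest; exists N. Qed.

Lemma generated_sub_orbit M Psi : Psi `<=` Theta M ->
  XX Psi `<=` orbit_closure (x M).
Proof.
move=> PsiM; rewrite orbit_closureE; apply: generated_subshift_min.
- exact: generated_closed.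
- exact: generated_S_invariant.
- move=> _ [N /PsiM NM <-]; rewrite -orbit_closureE.
  exact: (Theta_points b_odd b_ge5 D_good NM).
Qed.

(** A member [N] of [Psi] that omits some [r] has [N - r] empty.  If [N] omits
nothing, then so does [M], because [N] is a limit of labels [M - s], all
contained in [M]; but then no [M - s] is close to the empty label, which
contradicts the second hypothesis. *)
Lemma empty_label_mem Psi M : closed_invariant_label_sets (Theta M) Psi ->
  Theta M empty_label -> Psi empty_label.
Proof.
move=> [[N PN] _ Psi_inv PsiM] M0.
have [allN|] := EM (forall r, FIN r -> label_set N r); last first.
  move=> /existsNP[r /not_implyP[rF Nr]]; rewrite -(shift_label_empty Nr).
  by apply: (Psi_inv r rF); exists N.
exfalso.
have B0 K : BB K.+1 0 by split=> //; split=> //; apply: sub_finite_set (finite_set0 nat).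
have sub_M r : FIN r -> label_set M r.
  move=> rF; have [K rK] := FIN_BB rF.
  have /closure_agreeP /(_ K)[_ [s sF <-] NM] := PsiM _ PN.
  have [+ _] := agreeP NM rK => /(_ (allN r rF)) [_ Mrs].
  by apply: label_le Mrs; apply/lefP => l; rewrite leEnat; exact: leq_addr.
have /closure_agreeP /(_ 1%N)[_ [s sF <-] M0s] := M0.
have [_] := agreeP M0s (B0 0%N).
by apply; split; [case: (B0 0%N)|rewrite add0r; exact: sub_M].
Qed.

(** Injectivity compares two label sets one label at a time: nonempty labels are
recovered from the generated subshift, the empty one by [empty_label_mem].  For
surjectivity the label set attached to [Y] is the set of all labels whose points
lie in [Y]. *)
Lemma correspondence M :
  [/\ set_fun (closed_invariant_label_sets (Theta M))
         (closed_invariant_subsets (orbit_closure (x M))) (fun Psi => XX Psi),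
       set_inj (closed_invariant_label_sets (Theta M)) (fun Psi => XX Psi) &
       finite_type M ->
       forall Y : set shift_space,
       closed_invariant_subsets (orbit_closure (x M)) Y ->
       exists Psi : set LAB,
         [/\ closed_invariant_label_sets (Theta M) Psi,
             Y = XX Psi,
             points_in b D p (XX Psi) = Psi &
             Y = XX (points_in b D p Y)]].
Proof.
split.
- move=> Psi [[N PN] Psi_cl Psi_inv PsiM]; split.
  + by exists (x N); exact: generated_point.
  + exact: generated_closed.
  + exact: generated_S_invariant.
  + exact: generated_sub_orbit.
- have sub Psi1 Psi2 : closed_invariant_label_sets (Theta M) Psi1 ->
      closed_invariant_label_sets (Theta M) Psi2 ->
      XX Psi1 = XX Psi2 -> Psi1 `<=` Psi2.
    move=> P1 P2 X12 N P1N; have [_ P2cl P2inv P2M] := P2.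
    have [NE|N0] := label_emptyP N.
      by rewrite NE in P1N *; apply: (empty_label_mem P2); have [_ _ _] := P1; exact.
    apply: points_in_generated => //; rewrite /points_in /= -X12.
    exact: generated_point.
  move=> Psi1 Psi2 /set_mem P1 /set_mem P2 X12.
  by apply/seteqP; split; exact: sub.
move=> Mfin Y [[y0 Yy0] Ycl Yinv YM].
have M0 : Theta M empty_label.
  have [r rF Mr] := finite_type_proper Mfin; rewrite -(shift_label_empty Mr).
  by apply: subset_closure; exists r.
have YS := (S_invariantP Y).1 Yinv.
have YE y : Y y -> exists u N, y = Siter u (x N) /\ points_in b D p Y N.
  move=> Yy; suff [u [N yE]] : exists u N, y = Siter u (x N).
    exists u, N; split=> //; rewrite /points_in /=.
    have -> : x N = Siter (- u) y; last exact: YS.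
    by rewrite yE; apply/funext => t; rewrite /Siter subrK.
  have [[a ya]|y_false] := EM (exists a, y a).
    by apply: finite_type_limit Mfin _ ya; rewrite -orbit_closureE; exact: YM.
  exists 0, empty_label; apply/funext => t; apply: bool_iff_eq; rewrite /Siter xdigitP.
  by split=> [yt|[]//]; exfalso; apply: y_false; exists t.
have YX : Y = XX (points_in b D p Y).
  apply/seteqP; split; last by apply: generated_subshift_min => // _ [N YN <-].
  move=> y /YE[u [N [-> YN]]].
  have /S_invariantP := @generated_S_invariant (x @` points_in b D p Y); apply.
  exact: generated_point.
exists (points_in b D p Y); split=> //; last by rewrite -YX.
split.
- by have [u [N [_ YN]]] := YE _ Yy0; exists N.
- exact: closed_points_in.
- exact: FIN_invariant_points_in.
- move=> N YN; have [->//|N0] := label_emptyP N.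
  have : closure (orbits (x @` [set M])) (x N).
    by rewrite image_set1 -generated_subshiftE -orbit_closureE; exact: YM.
  move=> /(label_of_limit_point b_odd b_ge5 D_good N0); apply: closureS.
  by move=> _ [_ -> [r rF <-]]; exists r.
Qed.

End Correspondence.

Lemma xlabE b D : odd b -> (5 <= b)%N -> xlab b D = xdigit b D false.
Proof.
move=> b_odd b_ge5; apply/funext => M; congr charfun; apply/seteqP.
split=> t [].
  move=> /(IP_digit b_odd b_ge5) t_ok.
  by rewrite (length_vector_lenv b_odd b_ge5 D t_ok).
move=> t_ok; rewrite -(length_vector_lenv b_odd b_ge5 D t_ok) => Mt.
by split=> //; apply/(IP_digit b_odd b_ge5).
Qed.

Lemma IPdigit_sub b : IPdigit b true `<=` IPdigit b false.
Proof. by move=> t t_ok j; have := t_ok j; rewrite /ok_digit /= orbF => /orP[]->; rewrite ?orbT. Qed.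

Lemma xlab_plusE b D : odd b -> (5 <= b)%N -> xlab_plus b D = xdigit b D true.
Proof.
move=> b_odd b_ge5; apply/funext => M; congr charfun; apply/seteqP.
split=> t.
  move=> [[_ +] /(IP_plus_digit b_odd b_ge5) t_ok].
  by rewrite (length_vector_lenv b_odd b_ge5 D t_ok).
move=> [t_ok]; rewrite -(length_vector_lenv b_odd b_ge5 D t_ok) => Mt.
split; last exact/(IP_plus_digit b_odd b_ge5).
by split=> //; apply/(IP_digit b_odd b_ge5)/IPdigit_sub.
Qed.

Theorem corollary3p35 (b : nat) (D : nat -> set nat) (M : LAB)
    (b_odd : odd b) (b_ge5 : (5 <= b)%N) (D_good : good_partition D) :
  ([/\ set_fun (closed_invariant_label_sets (Theta M))
         (closed_invariant_subsets (Xlab b D M)) (X b D),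
       set_inj (closed_invariant_label_sets (Theta M)) (X b D) &
       finite_type M ->
       forall Y : set shift_space, closed_invariant_subsets (Xlab b D M) Y ->
       exists Psi : set LAB,
         [/\ closed_invariant_label_sets (Theta M) Psi,
             Y = X b D Psi,
             Phi b D (X b D Psi) = Psi &
             Y = X b D (Phi b D Y)]])
  /\
  ([/\ set_fun (closed_invariant_label_sets (Theta M))
         (closed_invariant_subsets (Xlab_plus b D M)) (X_plus b D),
       set_inj (closed_invariant_label_sets (Theta M)) (X_plus b D) &
       finite_type M ->
       forall Y : set shift_space, closed_invariant_subsets (Xlab_plus b D M) Y ->
       exists Psi : set LAB,
         [/\ closed_invariant_label_sets (Theta M) Psi,
             Y = X_plus b D Psi,
             Phi_plus b D (X_plus b D Psi) = Psi &
             Y = X_plus b D (Phi_plus b D Y)]]).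
Proof.
have xE := xlabE D b_odd b_ge5; have x_plusE := xlab_plusE D b_odd b_ge5.
split.
  have := correspondence b_odd b_ge5 D_good false M.
  by rewrite /X /Xlab /Phi xE.
have := correspondence b_odd b_ge5 D_good true M.
by rewrite /X_plus /Xlab_plus /Phi_plus x_plusE.
Qed.
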